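(* Let $n\in\mathbb{N}$, let $P,I,C\in\mathbb{R}_{max}^{n\times n}$ and let $\rho\in\mathbb{R}$. Then the output of Algorithm 1 (described in the context) on input $(P,I,C,\rho)$ is exactly the set $$\{\lambda\in\mathbb{R}\ :\ \mathcal{G}(\lambda\otimes(P\oplus\rho^{-1}\otimes E_\otimes)\oplus\lambda^{-1}\otimes I\oplus C)\in\Gamma\},$$ and the output of Algorithm 2 (described in the context) on input $(P,I,C,\rho)$ is exactly the set $$\{\lambda\in\mathbb{R}\ :\ \mathcal{G}(\lambda\otimes P\oplus\lambda^{-1}\otimes(I\oplus\rho\otimes E_\otimes)\oplus C)\in\Gamma\}.$$
   Context: Max-plus algebra: $\mathbb{R}_{max}=\mathbb{R}\cup\{-\infty\}$, $\bar{\mathbb{R}}_{max}=\mathbb{R}\cup\{-\infty,+\infty\}$, with $a\oplus b=\max(a,b)$ and $a\otimes b=a+b$, where $-\infty$ is absorbing for $\otimes$ (in particular $(-\infty)\otimes(+\infty)=-\infty$). For $\lambda\in\mathbb{R}$, $\lambda^{-1}=-\lambda$; $(+\infty)^{-1}=-\infty$, $(-\infty)^{-1}=+\infty$. Matrix operations: $(A\oplus B)_{ij}=A_{ij}\oplus B_{ij}$, $(A\otimes B)_{ij}=\bigoplus_k A_{ik}\otimes B_{kj}$, $(\lambda\otimes A)_{ij}=\lambda\otimes A_{ij}$; $E_\otimes$ is the $n\times n$ matrix with $0$ on the diagonal and $-\infty$ elsewhere; $A^0=E_\otimes$, $A^{k+1}=A\otimes A^k$, and $A^*=\bigoplus_{k\ge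 0}A^k$ (entrywise supremum, possibly $+\infty$). The precedence graph $\mathcal{G}(A)$ of $A\in\bar{\mathbb{R}}_{max}^{n\times n}$ has nodes $\{1,\dots,n\}$, an arc $(j,i)$ iff $A_{ij}\neq-\infty$, with weight $A_{ij}$; the weight of a path is the sum of its arc weights. $\Gamma$ denotes the set of precedence graphs containing no circuit of positive weight. The maximum circuit mean is $\mathrm{mcm}(A)=\bigoplus_{k=1}^n(\mathrm{tr}(A^k))^{1/k}$, where $\mathrm{tr}(M)=\bigoplus_i M_{ii}$ and $a^{1/k}$ is $a/k$ in standard arithmetic (with $\pm\infty$ mapped to themselves). Algorithm 1 on input $(P,I,C,\rho)$: if $\mathcal{G}(C)\notin\Gamma$ return $\emptyset$. Otherwise set $P'=P\oplus\rho^{-1}\otimes E_\otimes$, $\hat P=C^*\otimes P'\otimes C^*$, $\hat I=C^*\otimes I\otimes C^*$, $S=E_\otimes$, and for $k=1,\dots,\lfloor n/2\rfloor$ replace $S$ by $\hat P\otimes S^2\otimes\hat I\oplus\hat I\otimes S^2\otimes\hat P\oplus E_\otimes$. If $\mathcal{G}(S)\notin\Gamma$ return $\emptyset$. Otherwise let $\lambda_{min}=\mathrm{mcm}(\hat I\otimes S^* )$ and $\lambda_{max}=(\mathrm{mcm}(\hat P\otimes S^* ))^{-1}$; if $\lambda_{min}>\lambda_{max}$ return $\emptyset$, else return $[\lambda_{min},\lambda_{max}]\cap\mathbb{R}$. Algorithm 2 is identical except that $P'=P$ and $I$ is replaced by $I'=I\oplus\rho\otimes E_\otimes$ before forming $\hat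 I=C^*\otimes I'\otimes C^*$. *)

(* Defs.v *)
From HB Require Import structures.
From mathcomp Require Import all_boot all_order all_algebra.
From mathcomp Require Import boolp classical_sets reals constructive_ereal ereal.

Set Implicit Arguments.
Unset Strict Implicit.
Unset Printing Implicit Defensive.

Import Order.TTheory GRing.Theory Num.Theory.

Declare Scope maxplus_scope.
Delimit Scope maxplus_scope with MP.

Local Open Scope classical_set_scope.
Local Open Scope ring_scope.

(* The scalar operations of max-plus algebra on [\bar R] are [maxe] (with
   neutral element [-oo]), [adde] (for which [-oo + +oo = -oo]) and, for the
   inverse, [oppe]. *)
Section MaxPlus.
Variables (R : realType) (n : nat).
Implicit Types (A B : 'M[\bar R]_n) (a : \bar R).

Definition is_Rmax_mx A : Prop := forall i j, A i j <> +oo%E.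

Definition mp_add A B : 'M[\bar R]_n := \matrix_(i, j) maxe (A i j) (B i j).

Definition mp_mul A B : 'M[\bar R]_n :=
  \matrix_(i, j) \big[maxe/-oo%E]_(k < n) (A i k + B k j)%E.

Definition mp_scale a A : 'M[\bar R]_n := \matrix_(i, j) (a + A i j)%E.

Definition mp_one : 'M[\bar R]_n :=
  \matrix_(i, j) (if i == j then 0 else -oo)%E.

Definition mp_exp A (k : nat) : 'M[\bar R]_n := iter k (mp_mul A) mp_one.

Definition mp_star A : 'M[\bar R]_n :=
  \matrix_(i, j) ereal_sup (range (fun k : nat => mp_exp A k i j)).

Definition mp_tr A : \bar R := \big[maxe/-oo%E]_(i < n) A i i.

Definition mp_root (k : nat) a : \bar R := er_map (fun x : R => x / k%:R) a.

Definition mcm A : \bar R :=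
  \big[maxe/-oo%E]_(1 <= k < n.+1) mp_root k (mp_tr (mp_exp A k)).

End MaxPlus.

Arguments mp_one {R n}.

Notation "A ⊕ B" := (mp_add A B) (at level 50, left associativity)
  : maxplus_scope.
Notation "A ⊗ B" := (mp_mul A B) (at level 40, left associativity)
  : maxplus_scope.
Notation "a ⊙ A" := (mp_scale a A) (at level 40, left associativity)
  : maxplus_scope.

Section Graph.
Variables (R : realType) (n : nat).

Record wgraph := WGraph {
  arc : rel 'I_n;
  arc_weight : 'I_n -> 'I_n -> \bar R  (* meaningful on arcs only *)
}.

(* The arc from [j] to [i] carries the entry [A i j]. *)
Definition precedence_graph (A : 'M[\bar R]_n) : wgraph :=
  {| arc := fun j i => A i j != -oo%E; arc_weight := fun j i => A i j |}.

Fixpoint path_weight (G : wgraph) (x : 'I_n) (p : seq 'I_n) : \bar R :=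
  if p is y :: q then (arc_weight G x y + path_weight G y q)%E else 0%E.

(* The circuit [x -> p_1 -> ... -> p_m -> x], of length [m + 1 >= 1]. *)
Definition is_circuit (G : wgraph) (x : 'I_n) (p : seq 'I_n) : bool :=
  path (arc G) x (rcons p x).

Definition circuit_weight (G : wgraph) (x : 'I_n) (p : seq 'I_n) : \bar R :=
  path_weight G x (rcons p x).

Definition Gamma : set wgraph :=
  [set G | ~ exists x p, is_circuit G x p /\ (0 < circuit_weight G x p)%E].

End Graph.

Section Algorithms.
Variables (R : realType) (n : nat).
Implicit Types (P I C S : 'M[\bar R]_n).
Local Open Scope maxplus_scope.

Definition S_step (Phat Ihat S : 'M[\bar R]_n) : 'M[\bar R]_n :=
  Phat ⊗ mp_exp S 2 ⊗ Ihat ⊕ Ihat ⊗ mp_exp S 2 ⊗ Phat ⊕ mp_one.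

(* The instructions common to both algorithms, [P] and [I] standing for the
   matrices already modified by [rho]. *)
Definition algorithm_body P I C : set R :=
  if ~~ `[< Gamma (precedence_graph C) >] then set0 else
  let Phat := mp_star C ⊗ P ⊗ mp_star C in
  let Ihat := mp_star C ⊗ I ⊗ mp_star C in
  let S := iter n./2 (S_step Phat Ihat) mp_one in
  if ~~ `[< Gamma (precedence_graph S) >] then set0 else
  let lmin := mcm (Ihat ⊗ mp_star S) in
  let lmax := (- mcm (Phat ⊗ mp_star S))%E in
  if (lmax < lmin)%E then set0 else
  [set l : R | (lmin <= l%:E)%E /\ (l%:E <= lmax)%E].

Definition algorithm1 P I C (rho : R) : set R :=
  algorithm_body (P ⊕ (- rho)%:E ⊙ mp_one) I C.

Definition algorithm2 P I C (rho : R) : set R :=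
  algorithm_body P (I ⊕ rho%:E ⊙ mp_one) C.

End Algorithms.

(* Main.v *)
Require Import Defs.
From HB Require Import structures.
From mathcomp Require Import all_boot all_order all_algebra.
From mathcomp Require Import boolp classical_sets reals constructive_ereal ereal.
From mathcomp Require Import zify lra.

(** A graph without arcs of weight [+oo] has no circuit of positive weight iff it
    admits a real potential, and potentials pass through products and stars.
    Hence a potential for [λP ⊕ λ⁻¹I ⊕ C] bounds every quantity the algorithm
    computes, and every feasible [λ] is in the output.

    Conversely it suffices to bound elementary circuits, which have length at
    most [n].  Absorbing the [C]-arcs into the factors [mp_star C], such a circuit is
    a cyclic word of length at most [n] in [Phat] and [Ihat].  A balanced word of
    length at most [2k] is dominated by the square of the [k]-th iterate of
    [S]; a word with [d] more letters [Ihat] than [Phat] is, after rotation, a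
    concatenation of [d] factors, each [Ihat] followed by a balanced word, so it is
    dominated by the [d]-th power of [Ihat ⊗ mp_star S] and controlled by [mcm] (and symmetrically for
    [Phat]). *)

Import Order.TTheory GRing.Theory Num.Theory.

Local Open Scope classical_set_scope.
Local Open Scope ring_scope.
Local Open Scope maxplus_scope.

Set Implicit Arguments.
Unset Strict Implicit.
Unset Printing Implicit Defensive.

(** * Max-plus products, powers and their entrywise order *)

Section MaxPlusOrder.
Variables (R : realType) (n : nat).
Implicit Types (A B D Ph Ih : 'M[\bar R]_n).

Definition mp_le A B : Prop := forall i j, (A i j <= B i j)%E.

Lemma mp_le_refl A : mp_le A A.
Proof. by move=> i j. Qed.

Lemma mp_le_trans B A D : mp_le A B -> mp_le B D -> mp_le A D.
Proof. by move=> AB BD i j; apply: le_trans (AB i j) (BD i j). Qed.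

Lemma mp_mul_leP A B i j (z : \bar R) :
  (forall k, (A i k + B k j <= z)%E) <-> ((A ⊗ B) i j <= z)%E.
Proof.
rewrite mxE; split=> [h|/bigmax_leP[_ h] k]; last exact: h.
by apply: bigmax_le => [|k _]; [exact: leNye | exact: h].
Qed.

Lemma le_mp_mul A B i k j : (A i k + B k j <= (A ⊗ B) i j)%E.
Proof. by move: k; apply/mp_mul_leP. Qed.

Lemma mp_mul_mono A A' B B' :
  mp_le A A' -> mp_le B B' -> mp_le (A ⊗ B) (A' ⊗ B').
Proof.
move=> hA hB i j; apply/mp_mul_leP => k.
exact: le_trans (leeD (hA _ _) (hB _ _)) (le_mp_mul _ _ _ _ _).
Qed.

Lemma mp_mulA A B D : A ⊗ (B ⊗ D) = (A ⊗ B) ⊗ D.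
Proof.
apply/matrixP => i j; rewrite !mxE.
under eq_bigr => k _ do
  rewrite mxE (big_morph (+%E (A i k)) (adde_maxr (A i k)) (addeNy _)).
rewrite exchange_big /=; apply: eq_bigr => k _.
rewrite mxE (big_morph (+%E^~ (D k j)) (fun x y => adde_maxl _ _ _) (addNye _)).
by apply: eq_bigr => l _; rewrite addeA.
Qed.

Lemma mp_mul1 A : mp_one ⊗ A = A.
Proof.
apply/matrixP => i j; apply/eqP; rewrite eq_le; apply/andP; split.
  apply/mp_mul_leP => k; rewrite mxE; case: eqP => [->|_]; first by rewrite add0e.
  by rewrite addNye leNye.
by apply: le_trans (le_mp_mul _ _ i i j); rewrite mxE eqxx add0e.
Qed.

Lemma mp_mulm1 A : A ⊗ mp_one = A.
Proof.
apply/matrixP => i j; apply/eqP; rewrite eq_le; apply/andP; split.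
  apply/mp_mul_leP => k; rewrite mxE; case: eqP => [->|_]; first by rewrite adde0.
  by rewrite addeNy leNye.
by apply: le_trans (le_mp_mul _ _ i j j); rewrite [mp_one _ _]mxE eqxx adde0.
Qed.

Lemma mp_add_lel A B : mp_le A (A ⊕ B).
Proof. by move=> i j; rewrite mxE le_max lexx. Qed.

Lemma mp_add_ler A B : mp_le B (A ⊕ B).
Proof. by move=> i j; rewrite mxE le_max lexx orbT. Qed.

Lemma mp_exp2 A : mp_exp A 2 = A ⊗ A.
Proof. by rewrite /mp_exp /= mp_mulm1. Qed.

Lemma mp_expSr A k : mp_exp A k.+1 = mp_exp A k ⊗ A.
Proof.
elim: k => [|k IH]; first by rewrite /mp_exp /= mp_mulm1 mp_mul1.
by transitivity (A ⊗ mp_exp A k.+1) => //; rewrite [in LHS]IH mp_mulA.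
Qed.

Lemma mp_exp_le_star A k : mp_le (mp_exp A k) (mp_star A).
Proof. by move=> i j; rewrite [leRHS]mxE; apply: ereal_sup_ubound; exists k. Qed.

Lemma mp_le_mull A B : mp_le mp_one A -> mp_le B (A ⊗ B).
Proof.
by move=> h; rewrite -{1}[B]mp_mul1; apply: mp_mul_mono => //; apply: mp_le_refl.
Qed.

Lemma le_mp_tr A i : (A i i <= mp_tr A)%E.
Proof. exact: (le_bigmax -oo%E (fun i => A i i)). Qed.

Lemma mp_tr_mono A B : mp_le A B -> (mp_tr A <= mp_tr B)%E.
Proof. by move=> h; apply: le_bigmax2 => i _; apply: h. Qed.

Lemma mp_tr_mulC A B : mp_tr (A ⊗ B) = mp_tr (B ⊗ A).
Proof.
rewrite /mp_tr; under eq_bigr => i _ do rewrite mxE.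
under [RHS]eq_bigr => i _ do rewrite mxE.
rewrite exchange_big; apply: eq_bigr => i _; apply: eq_bigr => j _.
by rewrite addeC.
Qed.

Lemma mcm_leP A (x : R) :
  (mcm A <= x%:E)%E <->
  forall k, (0 < k <= n)%N -> (mp_tr (mp_exp A k) <= (k%:R * x)%:E)%E.
Proof.
have root_le k (a : \bar R) : (0 < k)%N ->
    (mp_root k a <= x%:E)%E = (a <= (k%:R * x)%:E)%E.
  move=> k0; case: a => [a| |] //=; last by rewrite !leNye.
  by rewrite !lee_fin ler_pdivrMr ?ltr0n // mulrC.
split=> [h k /andP[k0 kn]|h].
  rewrite -root_le //; apply: le_trans h.
  by rewrite /mcm; apply: (le_bigmax_seq _ k); rewrite // mem_index_iota k0.
rewrite /mcm big_nat_cond; apply: bigmax_le => [|k]; first exact: leNye.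
by rewrite andbT => /andP[k0 kn]; rewrite root_le // h // k0.
Qed.

Lemma is_Rmax_add A B : is_Rmax_mx A -> is_Rmax_mx B -> is_Rmax_mx (A ⊕ B).
Proof. by move=> hA hB i j; rewrite mxE; rewrite /Order.max; case: ifP. Qed.

Lemma is_Rmax_scale (a : R) A : is_Rmax_mx A -> is_Rmax_mx (a%:E ⊙ A).
Proof. by move=> hA i j; rewrite mxE; have := hA i j; case: (A i j). Qed.

Lemma is_Rmax_one : is_Rmax_mx (@mp_one R n).
Proof. by move=> i j; rewrite mxE; case: ifP. Qed.

Lemma is_Rmax_mul A B : is_Rmax_mx A -> is_Rmax_mx B -> is_Rmax_mx (A ⊗ B).
Proof.
move=> hA hB i j; rewrite mxE; elim/big_ind: _ => // [x y hx hy|k _].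
  by rewrite /Order.max; case: ifP.
by have := hA i k; have := hB k j; case: (A i k); case: (B k j).
Qed.

Lemma is_Rmax_S_iter Ph Ih k :
  is_Rmax_mx Ph -> is_Rmax_mx Ih -> is_Rmax_mx (iter k (S_step Ph Ih) mp_one).
Proof.
move=> hP hI; elim: k => [|k IH]; first exact: is_Rmax_one.
rewrite iterS /S_step mp_exp2.
apply: is_Rmax_add; last exact: is_Rmax_one.
by apply: is_Rmax_add; do !apply: is_Rmax_mul.
Qed.

(* Up to the slack [c], [v] is a potential for the graph of [A]: conjugating by
   [v] makes every entry of [A] at most [c]. *)
Definition potential (v : 'I_n -> R) (c : R) A : Prop :=
  forall i j, (A i j <= (v i - v j + c)%:E)%E.

(** * Potentials under the max-plus operations *)

Section Potential.
Variable v : 'I_n -> R.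

Lemma potential_Rmax c A : potential v c A -> is_Rmax_mx A.
Proof. by move=> h i j e; have := h i j; rewrite e. Qed.

Lemma potential_le c A B : mp_le A B -> potential v c B -> potential v c A.
Proof. by move=> AB h i j; apply: le_trans (AB i j) (h i j). Qed.

Lemma potential_one : potential v 0 mp_one.
Proof.
move=> i j; rewrite mxE; case: eqP => [->|_]; last exact: leNye.
by rewrite subrr addr0.
Qed.

Lemma potential_add c A B :
  potential v c A -> potential v c B -> potential v c (A ⊕ B).
Proof. by move=> hA hB i j; rewrite mxE ge_max hA hB. Qed.

Lemma potential_mul c d A B :
  potential v c A -> potential v d B -> potential v (c + d) (A ⊗ B).
Proof.
move=> hA hB i j; apply/mp_mul_leP => k.
by apply: le_trans (leeD (hA i k) (hB k j)) _; rewrite -EFinD lee_fin; lra.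
Qed.

Lemma potential_exp c A k : potential v c A -> potential v (k%:R * c) (mp_exp A k).
Proof.
move=> hA; elim: k => [|k IH]; first by rewrite mul0r; exact: potential_one.
have -> : k.+1%:R * c = c + k%:R * c by rewrite mulrS mulrDl mul1r.
exact: potential_mul.
Qed.

Lemma potential_star A : potential v 0 A -> potential v 0 (mp_star A).
Proof.
move=> hA i j; rewrite mxE; apply: ge_ereal_sup => _ [k _ <-].
by have := potential_exp k hA; rewrite mulr0; apply.
Qed.

(** Each product in [S_step] has one factor [Ph] and one factor [Ih], so the slacks [- x] and [x]
    cancel. *)
Lemma potential_S_iter x Ph Ih k : potential v (- x) Ph -> potential v x Ih ->
  potential v 0 (iter k (S_step Ph Ih) mp_one).
Proof.
move=> hP hI; elim: k => [|k IH]; first exact: potential_one.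
rewrite iterS /S_step mp_exp2; have hSS := potential_mul IH IH.
apply: potential_add; last exact: potential_one.
apply: potential_add.
  rewrite (_ : 0 = - x + (0 + 0) + x); last by lra.
  by apply: potential_mul => //; exact: potential_mul.
rewrite (_ : 0 = x + (0 + 0) - x); last by lra.
by apply: potential_mul => //; exact: potential_mul.
Qed.

Lemma potential_tr c A : potential v c A -> (mp_tr A <= c%:E)%E.
Proof.
move=> h; apply: bigmax_le => [|i _]; first exact: leNye.
by apply: le_trans (h i i) _; rewrite subrr add0r.
Qed.

Lemma potential_mcm c A : potential v c A -> (mcm A <= c%:E)%E.
Proof. by move=> h; apply/mcm_leP => k _; apply/potential_tr/potential_exp. Qed.

Lemma potential_path_weight A x p : potential v 0 A ->
  (path_weight (precedence_graph A) x p <= (v (last x p) - v x)%:E)%E.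
Proof.
move=> h; elim: p x => [|y p IH] x /=; first by rewrite subrr.
by apply: le_trans (leeD (h y x) (IH y)) _; rewrite -EFinD lee_fin; lra.
Qed.

Lemma potential_Gamma A : potential v 0 A -> Gamma (precedence_graph A).
Proof.
move=> h [x [p [_]]]; apply/negP; rewrite -leNgt.
by apply: le_trans (potential_path_weight _ _ h) _; rewrite last_rcons subrr.
Qed.

End Potential.
End MaxPlusOrder.

(** * Elementary circuits and the existence of potentials *)

Section Circuits.
Variables (R : realType) (n : nat).
Implicit Types (G : wgraph R n) (A : 'M[\bar R]_n).

Lemma path_weight_cat G x p q :
  path_weight G x (p ++ q) = (path_weight G x p + path_weight G (last x p) q)%E.
Proof. by elim: p x => [|y p IH] x /=; rewrite ?add0e // IH addeA. Qed.

(** This ranges over all node sequences, not only circuits: in a precedence graph a missing arc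
    weighs [-oo], and so does every walk through it. *)
Definition elementary_nonpositive G : Prop :=
  forall x p, uniq (x :: p) -> (circuit_weight G x p <= 0)%E.

(** Loops are erased from the right: if [x] already occurs on the erased walk, the part leading back
    to [x] is an elementary circuit of weight at most 0 and is dropped. *)
Lemma loop_erasure G x p : elementary_nonpositive G ->
  exists q, [/\ uniq (x :: q), last x q = last x p &
                (path_weight G x p <= path_weight G x q)%E].
Proof.
move=> hG; elim: p x => [|y p IH] x; first by exists [::].
have [q [uq lq wq]] := IH y.
have wle : (path_weight G x (y :: p) <= path_weight G x (y :: q))%E.
  by rewrite /= leeD2l.
have [xq|xq] := boolP (x \in y :: q); last first.
  by exists (y :: q); split=> //; rewrite cons_uniq xq.
have lq' : last x (y :: q) = last x (y :: p) by [].
case/splitPr: xq uq lq' wle => p1 p2 uq lq' wle; exists p2.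
move: uq; rewrite cat_uniq /= negb_or => /and3P[u1 /andP[xp1 _] u2].
split=> //; first by move: lq'; rewrite last_cat.
apply: le_trans wle _; rewrite -cat_rcons path_weight_cat last_rcons.
by rewrite -[leRHS]add0e leeD2r // hG //= xp1.
Qed.

Lemma elementary_nonpositive_Gamma G : elementary_nonpositive G -> Gamma G.
Proof.
move=> hG [x [p [_]]]; apply/negP; rewrite -leNgt.
have [q [uq lq]] := loop_erasure x (rcons p x) hG.
(* The erased walk returns to [x] without repetition, so it is empty and has weight 0. *)
rewrite last_rcons in lq; case: q uq lq => //= y q /andP[xq _] lq.
by rewrite -lq mem_last in xq.
Qed.

Lemma Gamma_elementary_nonpositive A :
  Gamma (precedence_graph A) -> elementary_nonpositive (precedence_graph A).
Proof.
move=> hG x p _; rewrite leNgt; apply/negP => hw; apply: hG; exists x, p.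
split=> //; move: hw; rewrite /circuit_weight /is_circuit.
have hNy y q : ~~ path (Defs.arc (precedence_graph A)) y q ->
    path_weight (precedence_graph A) y q = -oo%E.
  elim: q y => //= z q IH y; rewrite negb_and.
  by case/orP => [/negPn/eqP->|/IH->]; rewrite ?addNye ?addeNy.
by case: (boolP (path _ x (rcons p x))) => // /hNy ->.
Qed.

(* The potential of a node is the supremum of the weights of the walks that end
   there; it is finite because elementary walks dominate. *)
Lemma Gamma_potential A : is_Rmax_mx A -> Gamma (precedence_graph A) ->
  exists v, potential v 0 A.
Proof.
move=> hA /Gamma_elementary_nonpositive hG.
(* [b] bounds every entry; an elementary walk has fewer than [n] arcs, hence weight at most
   [n%:R * b]. *)
pose b : R := \sum_i \sum_j `|fine (A i j)|.
have b0 : 0 <= b by do 2![apply: sumr_ge0 => ? _].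
have Ab i j : (A i j <= b%:E)%E.
  have := hA i j; case E: (A i j) => [a| |] // _; last exact: leNye.
  rewrite lee_fin /b (bigD1 i) //= (bigD1 j) //= E /= -addrA.
  apply: le_trans (ler_norm a) _; rewrite lerDl.
  by apply: addr_ge0; apply: sumr_ge0 => // ? _; apply: sumr_ge0.
have walk_le x p : (path_weight (precedence_graph A) x p <= (n%:R * b)%:E)%E.
  have [q [uq _ /le_trans]] := loop_erasure x p hG; apply.
  have sq : (size q <= n)%N.
    apply: ltnW; have := max_card (mem (x :: q)).
    by rewrite (card_uniqP uq) card_ord.
  apply: (@le_trans _ _ ((size q)%:R * b)%:E); last first.
    by rewrite lee_fin ler_wpM2r // ler_nat.
  elim: q x {uq sq} => [|y q IH] x /=; first by rewrite mul0r.
  apply: le_trans (leeD (Ab y x) (IH y)) _.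
  by rewrite -EFinD lee_fin mulrSr mulrDl mul1r addrC.
pose W i := [set t | exists x p, last x p = i /\
                       t = path_weight (precedence_graph A) x p].
pose s i := ereal_sup (W i).
have s0 i : (0 <= s i)%E by apply: ereal_sup_ubound; exists i, [::].
have sb i : (s i <= (n%:R * b)%:E)%E.
  by apply: ge_ereal_sup => _ [x [p [_ ->]]].
have sE i : s i = (fine (s i))%:E.
  by have := s0 i; have := sb i; case: (s i).
exists (fun i => fine (s i)) => i j; have := hA i j.
case E: (A i j) => [a| |] // _; last exact: leNye.
rewrite addr0 EFinB -!sE leeBrDl; last by rewrite sE.
rewrite -leeBrDr //; apply: ge_ereal_sup => _ [x [p [lp ->]]].
rewrite leeBrDr //; apply: ereal_sup_ubound; exists x, (rcons p i).
by rewrite last_rcons; split=> //; rewrite -cats1 path_weight_cat lp /= E adde0.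
Qed.

End Circuits.

(** * Balanced words in two letters *)

Definition occ (c : bool) (w : seq bool) : nat := count_mem c w.

Lemma occ_cat c w1 w2 : occ c (w1 ++ w2) = (occ c w1 + occ c w2)%N.
Proof. exact: count_cat. Qed.

Lemma occ_nil c : occ c [::] = 0%N.
Proof. by []. Qed.

Lemma occ_cons c w : occ c (c :: w) = (occ c w).+1.
Proof. by rewrite /occ /= eqxx. Qed.

Lemma occ_consN c w : occ c (~~ c :: w) = occ c w.
Proof. by case: c. Qed.

Lemma occN_cons c w : occ (~~ c) (c :: w) = occ (~~ c) w.
Proof. by case: c. Qed.

Lemma occ_rcons c d w : occ c (rcons w d) = occ c (d :: w).
Proof. by rewrite /occ -cats1 count_cat /= addn0 addnC. Qed.

Lemma size_occ c w : size w = (occ c w + occ (~~ c) w)%N.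
Proof. by elim: w => //= -[] w ->; rewrite /occ; case: c => /=; lia. Qed.

Definition occE := (occ_nil, occ_cat, occ_rcons, occ_cons, occ_consN, occN_cons).

Definition balanced (w : seq bool) : Prop := occ true w = occ false w.

Lemma balancedE c w : balanced w <-> occ c w = occ (~~ c) w.
Proof. by case: c; rewrite /balanced; split. Qed.

Lemma neqb_negb (b c : bool) : b != c -> b = ~~ c.
Proof. by case: b c => -[]. Qed.

(** Strip the last letter: either the rest still has an excess of [c], or the rest is balanced and
    that letter is the [c] sought. *)
Lemma first_passage (c : bool) w : (occ (~~ c) w < occ c w)%N ->
  exists b w', w = b ++ c :: w' /\ balanced b.
Proof.
elim/last_ind: w => // w x IH h.
have [/IH[b [w' [-> bb]]]|hw] := ltnP (occ (~~ c) w) (occ c w).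
  by exists b, (rcons w' x); rewrite rcons_cat.
exists w, [::]; rewrite cats1; have [xc|] := eqVneq x c.
  by rewrite xc (balancedE c); split=> //; move: h; rewrite xc !occE; lia.
by move/neqb_negb => xc; move: h; rewrite xc !occE; lia.
Qed.

(** Count [c] as +1 and [~~ c] as -1: the partial sums are 1 after the first letter and -1 before
    the last, so somewhere they step from 1 through 0 to -1. The cut is made at that 0. *)
Lemma balanced_split (c : bool) m : balanced (c :: rcons m c) ->
  exists u v, [/\ balanced u, balanced v &
    c :: rcons m c = (c :: rcons u (~~ c)) ++ (~~ c :: rcons v c)].
Proof.
have [k] := ubnP (size m); elim: k m => // k IH m sm.
rewrite (balancedE c) !occE => hm.
have [|u [m' [Em bu]]] := @first_passage (~~ c) m; first by rewrite negbK; lia.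
move: (bu) hm sm; rewrite (balancedE c) Em !occE size_cat /= => bu'.
case: m' Em => [|x m'] Em hm sm; first by move: hm; rewrite !occE; lia.
have [xc|] := eqVneq x (~~ c).
  move: hm; rewrite xc !occE => hm.
  exists u, m'; split => //; first by rewrite (balancedE c); lia.
  by rewrite -!cats1 /= -!catA.
move/neqb_negb; rewrite negbK => xc; rewrite xc !occE in hm.
have [||u2 [v [bu2 bv E2]]] := IH m'; first by move: sm => /=; lia.
  by rewrite (balancedE c) !occE; lia.
exists (u ++ ~~ c :: c :: u2), v; split => //.
  by move/(balancedE c): bu2; rewrite (balancedE c) !occE; lia.
by rewrite rcons_cat /= xc E2 -!cats1 /= -?catA /= -?catA.
Qed.

(** * Matrix products along words *)

Section Words.
Variables (R : realType) (n : nat).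

(** The alphabet is a parameter: [bool] for words in the hat matrices, [option bool] for words that
    also contain [C]. *)
Definition word_mx (T : Type) (H : T -> 'M[\bar R]_n) (w : seq T) : 'M[\bar R]_n :=
  foldr (fun l B => H l ⊗ B) mp_one w.

Lemma word_mx_cat T (H : T -> 'M[\bar R]_n) w1 w2 :
  word_mx H (w1 ++ w2) = word_mx H w1 ⊗ word_mx H w2.
Proof. by elim: w1 => [|l w IH] /=; rewrite ?mp_mul1 // IH mp_mulA. Qed.

Lemma word_mx_rcons T (H : T -> 'M[\bar R]_n) w l :
  word_mx H (rcons w l) = word_mx H w ⊗ H l.
Proof. by rewrite -cats1 word_mx_cat /= mp_mulm1. Qed.

Lemma mp_tr_word_rot T (H : T -> 'M[\bar R]_n) w1 w2 :
  mp_tr (word_mx H (w1 ++ w2)) = mp_tr (word_mx H (w2 ++ w1)).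
Proof. by rewrite !word_mx_cat mp_tr_mulC. Qed.

Section BalancedWords.
Variable H : bool -> 'M[\bar R]_n.
(** With [true] standing for [Phat] and [false] for [Ihat], this is the algorithm's matrix after [k]
    rounds. *)
Let S k := iter k (S_step (H true) (H false)) mp_one.

Lemma one_le_S_iter k : mp_le mp_one (S k).
Proof. by case: k => [|k]; [exact: mp_le_refl | exact: mp_add_ler]. Qed.

Lemma S_iter_step c k : mp_le (H c ⊗ (S k ⊗ S k) ⊗ H (~~ c)) (S k.+1).
Proof.
apply: mp_le_trans (mp_add_lel _ _); rewrite mp_exp2.
by case: c; [exact: mp_add_lel | exact: mp_add_ler].
Qed.

(* A balanced word with distinct end letters is [c :: rcons m (~~ c)] with [m]
   balanced; otherwise [balanced_split] cuts it into two words of that form. *)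
Lemma balanced_word_le w k : balanced w -> (size w <= k.*2)%N ->
  mp_le (word_mx H w) (S k ⊗ S k).
Proof.
elim: k w => [|k IH] w bw sw.
  by case: w bw sw => // _ _; rewrite /= mp_mul1; exact: mp_le_refl.
(* With distinct end letters, the inner word is bounded by a square by induction and sits between
   [H c] and [H (~~ c)], as in a summand of [S_step]; a single factor [S k.+1] is then enough. *)
have prime c m : balanced m -> (size m <= k.*2)%N ->
    mp_le (word_mx H (c :: rcons m (~~ c))) (S k.+1).
  move=> bm sm; apply: mp_le_trans (S_iter_step c k) => /=.
  rewrite word_mx_rcons mp_mulA; apply: mp_mul_mono; last exact: mp_le_refl.
  by apply: mp_mul_mono (IH _ bm sm); exact: mp_le_refl.
case: w bw sw => [|c w] bw sw.
  exact: mp_le_trans (one_le_S_iter k.+1) (mp_le_mull _ (one_le_S_iter k.+1)).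
case/lastP: w bw sw => [|m e] bw sw; first by case: c bw {sw}.
rewrite /= size_rcons in sw.
have [ec|] := eqVneq e (~~ c).
  rewrite ec; apply: mp_le_trans (mp_le_mull _ (one_le_S_iter k.+1)).
  apply: prime; last by lia.
  by move/(balancedE c): bw; rewrite ec (balancedE c) !occE; lia.
move/neqb_negb; rewrite negbK => ec; rewrite ec in bw *.
have [u [v [bu bv E]]] := balanced_split bw.
have sE := congr1 size E; rewrite size_cat /= !size_rcons in sE.
rewrite E word_mx_cat; apply: mp_mul_mono; first by apply: prime => //; lia.
by rewrite -[in rcons v _](negbK c); apply: prime => //; lia.
Qed.

(** Cutting at successive first passages writes [c :: w] as [d.+1] blocks, each a [c] followed by a
    balanced word that [T] dominates. *)
Lemma excess_word_le c (T : 'M[\bar R]_n) N d w :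
  (forall b, balanced b -> (size b <= N)%N -> mp_le (word_mx H b) T) ->
  occ c w = (occ (~~ c) w + d)%N -> (size w <= N)%N ->
  mp_le (H c ⊗ word_mx H w) (mp_exp (H c ⊗ T) d.+1).
Proof.
move=> hT; elim: d w => [|d IH] w dw sw.
  rewrite /mp_exp /= mp_mulm1; apply: mp_mul_mono (mp_le_refl _) (hT _ _ sw).
  by rewrite (balancedE c) dw addn0.
have [|b [w' [Ew bb]]] := @first_passage c w; first by lia.
move: dw sw (bb); rewrite Ew !occE size_cat (balancedE c) /= => dw sw bb'.
rewrite word_mx_cat /= mp_mulA; apply: mp_mul_mono.
  by apply: mp_mul_mono (mp_le_refl _) (hT _ bb _); lia.
by apply: IH; lia.
Qed.

Lemma excess_tr_le c (y : R) w :
  (mcm (H c ⊗ mp_star (S n./2)) <= y%:E)%E -> (size w <= n)%N ->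
  (occ (~~ c) w < occ c w)%N ->
  (mp_tr (word_mx H w) <=
     (((occ c w)%:R - (occ (~~ c) w)%:R) * y)%:E)%E.
Proof.
move=> /mcm_leP hy sw lt.
have [b [w' [Ew bb]]] := first_passage lt.
pose d := (occ c w - occ (~~ c) w).-1.
have dE : (occ c w - occ (~~ c) w = d.+1)%N by rewrite /d; lia.
rewrite -natrB ?dE; last exact: ltnW.
have dn : (0 < d.+1 <= n)%N.
  by have := size_occ c w; rewrite -dE; lia.
apply: le_trans (hy _ dn); rewrite Ew mp_tr_word_rot; apply: mp_tr_mono => /=.
move: sw dE bb; rewrite Ew !occE size_cat (balancedE c) /= => sw dE bb.
(* After the rotation one letter is the leading [c], which leaves balanced words of at most [n.-1]
   letters; this is at most [n./2.*2], so [n./2] rounds suffice. *)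
apply: (@excess_word_le _ _ (n.-1)).
- move=> b' bb' sb'; apply: mp_le_trans (mp_exp_le_star _ 2).
  by rewrite mp_exp2; apply: balanced_word_le => //; lia.
- by rewrite !occE; lia.
- by rewrite size_cat; lia.
Qed.

(** Each sign of the excess has its own control: one [mcm] bound for either majority letter, and the
    potential [u] for balanced words. *)
Lemma word_tr_le (x : R) u w : potential u 0 (S n./2) ->
  (mcm (H false ⊗ mp_star (S n./2)) <= x%:E)%E ->
  (mcm (H true ⊗ mp_star (S n./2)) <= (- x)%:E)%E ->
  (size w <= n)%N ->
  (mp_tr (word_mx H w) <=
     (((occ false w)%:R - (occ true w)%:R) * x)%:E)%E.
Proof.
move=> hu hI hP sw.
have [lt|lt|bw] := ltngtP (occ true w) (occ false w).
- exact: excess_tr_le.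
- apply: le_trans (excess_tr_le hP sw lt) _.
  by rewrite lee_fin mulrN -mulNr opprB.
rewrite bw subrr mul0r -[0]addr0; apply: (@potential_tr _ _ u).
apply: potential_le (potential_mul hu hu); apply: balanced_word_le => //.
by have := size_occ true w; rewrite bw /=; lia.
Qed.

End BalancedWords.

(** * Spelling paths as words and absorbing [C] into its star *)

Section Absorption.
Variables (C : 'M[\bar R]_n) (L : bool -> 'M[\bar R]_n).
Let M (o : option bool) := if o is Some c then L c else C.
Let H c := mp_star C ⊗ L c ⊗ mp_star C.

Lemma one_le_star : mp_le mp_one (mp_star C).
Proof. exact: (mp_exp_le_star C 0). Qed.

(** [k] counts the factors [C] read since the last other letter. The first run goes into the leading
    star, each later run into the right-hand star of the hat matrix before it. *)
Lemma word_mx_absorb k w :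
  mp_le (mp_exp C k ⊗ word_mx M w) (mp_star C ⊗ word_mx H (pmap id w)).
Proof.
elim: w k => [|[c|] w IH] k /=.
- by rewrite !mp_mulm1; exact: mp_exp_le_star.
- apply: mp_mul_mono; first exact: mp_exp_le_star.
  have := IH 0; rewrite mp_mul1 => IH0.
  apply: mp_le_trans (mp_mul_mono (mp_le_refl _) IH0) _; rewrite mp_mulA.
  apply: mp_mul_mono; last exact: mp_le_refl.
  by rewrite /H -mp_mulA; apply/mp_le_mull/one_le_star.
- by rewrite mp_mulA -mp_expSr.
Qed.

(** When all letters are [C], no hat matrix can carry the stars; that case is settled by the
    potential. *)
Lemma mp_tr_word_absorb v w : potential v 0 C ->
  (mp_tr (word_mx M w) <= 0)%E /\ (forall c, count_mem (Some c) w = 0%N) \/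
  exists w', [/\ (size w' <= size w)%N,
    forall c, occ c w' = count_mem (Some c) w &
    (mp_tr (word_mx M w) <= mp_tr (word_mx H w'))%E].
Proof.
move=> hv; have [/hasP[[c|//] cw _]|] := boolP (has isSome w); last first.
  move=> /hasPn wN; left; split; last first.
    by elim: w wN => //= -[c|] w IH wN; [have := wN (Some c) (mem_head _ _) |
      apply: IH => o ow; apply: wN; rewrite inE ow orbT].
  apply: (@potential_tr _ _ v); elim: w wN => /= [|o w IH] wN.
    exact: potential_one.
  rewrite -[0]addr0; apply: potential_mul.
    by case: o wN => // c wN; have := wN (Some c) (mem_head _ _).
  by apply: IH => o' ow; apply: wN; rewrite inE ow orbT.
(* Rotated to begin with [Some c], the word has every run of [C] behind another letter, whose
   right-hand star takes it. *)
right; case/splitPr: cw => w1 w2; exists (c :: pmap id (w2 ++ w1)).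
have occ_pmap d w' : occ d (pmap id w') = count_mem (Some d) w'.
  by elim: w' => //= -[e|] w' /=; rewrite /occ /= => ->.
split=> [|d|].
- rewrite /= size_pmap size_cat /= addnS ltnS.
  by apply: leq_trans (count_size _ _) _; rewrite size_cat addnC.
- rewrite -[c :: _]/(pmap id (Some c :: w2 ++ w1)) occ_pmap /= !count_cat /=.
  by lia.
rewrite mp_tr_word_rot; apply: mp_tr_mono => /=.
have := word_mx_absorb 0 (w2 ++ w1); rewrite mp_mul1 => absorb.
apply: mp_le_trans (mp_mul_mono (mp_le_refl _) absorb) _; rewrite mp_mulA.
apply: mp_mul_mono; last exact: mp_le_refl.
by rewrite /H -mp_mulA; apply/mp_le_mull/one_le_star.
Qed.

(** Each arc takes its weight from one of the three matrices, recorded as a letter. Entry [A i j] is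
    the arc from [j] to [i], so the path is spelled backwards, its first arc being the last
    letter. *)
Lemma path_word (l : R) x p :
  let G := precedence_graph (l%:E ⊙ L true ⊕ (- l)%:E ⊙ L false ⊕ C) in
  exists2 w, size w = size p &
  (path_weight G x p <=
    (((count_mem (Some true) w)%:R - (count_mem (Some false) w)%:R) * l)%:E
    + word_mx M w (last x p) x)%E.
Proof.
move=> G; elim: p x => [|y p IH] x.
  by exists [::] => //=; rewrite mxE eqxx subrr mul0r add0e.
have [w sw hw] := IH y.
have step o (a : R) : (arc_weight G x y <= a%:E + M o y x)%E ->
    ((count_mem (Some true) (rcons w o))%:R
      - (count_mem (Some false) (rcons w o))%:R) * l
    = a + ((count_mem (Some true) w)%:R - (count_mem (Some false) w)%:R) * l ->
    exists2 w0, size w0 = size (y :: p) &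
      (path_weight G x (y :: p) <=
      (((count_mem (Some true) w0)%:R - (count_mem (Some false) w0)%:R) * l)%:E
      + word_mx M w0 (last x (y :: p)) x)%E.
  move=> ha hc; exists (rcons w o); first by rewrite size_rcons sw.
  apply: le_trans (leeD ha hw) _; rewrite hc word_mx_rcons EFinD.
  rewrite addeACA; apply: leeD2l; rewrite addeC; exact: le_mp_mul.
have cr o o' : count_mem o (rcons w o') = ((o' == o) + count_mem o w)%N.
  by rewrite -cats1 count_cat /= addn0 addnC.
have : (arc_weight G x y <= l%:E + L true y x)%E \/
    (arc_weight G x y <= (- l)%:E + L false y x)%E \/ (arc_weight G x y <= C y x)%E.
  rewrite /= !mxE !ge_max.
  by case: (leP (l%:E + L true y x)%E ((- l)%:E + L false y x)%E) => h1;
    [case: (leP ((- l)%:E + L false y x)%E (C y x)) |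
     case: (leP (l%:E + L true y x)%E (C y x))] => h2;
    rewrite ?h1 ?h2 ?lexx ?(ltW h1) ?(ltW h2) ?(le_trans h1 h2) ?(le_trans (ltW h1) h2); auto.
case=> [h|[h|h]].
- by apply: (step (Some true) l) => //; rewrite !cr /= add1n add0n mulrS; lra.
- by apply: (step (Some false) (- l)) => //; rewrite !cr /= add1n add0n mulrS; lra.
- by apply: (step None 0); rewrite ?add0e // !cr /= !add0n add0r.
Qed.

End Absorption.
End Words.

(** * Correctness of the algorithms *)

Section Correctness.
Variables (R : realType) (n : nat) (P I C : 'M[\bar R]_n).
Hypotheses (hP : is_Rmax_mx P) (hI : is_Rmax_mx I) (hC : is_Rmax_mx C).

Let Phat := mp_star C ⊗ P ⊗ mp_star C.
Let Ihat := mp_star C ⊗ I ⊗ mp_star C.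
Let S := iter n./2 (S_step Phat Ihat) mp_one.

Lemma feasible_potential (l : R) v :
  potential v 0 (l%:E ⊙ P ⊕ (- l)%:E ⊙ I ⊕ C) ->
  [/\ potential v 0 C, potential v (- l) P & potential v l I].
Proof.
move=> hv; split=> i j; have := hv i j; rewrite !mxE !ge_max -andbA => /and3P[].
- by [].
- by rewrite -leeBrDl // -EFinB addr0.
- by move=> _ + _; rewrite -leeBrDl // -EFinB addr0 opprK.
Qed.

(** The stars and [S] have slack 0, so [Ihat ⊗ mp_star S] has slack [l] and [Phat ⊗ mp_star S] slack
    [- l]; the slack bounds [mcm]. *)
Lemma feasible_output (l : R) :
  Gamma (precedence_graph (l%:E ⊙ P ⊕ (- l)%:E ⊙ I ⊕ C)) ->
  [/\ Gamma (precedence_graph C), Gamma (precedence_graph S),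
      (mcm (Ihat ⊗ mp_star S) <= l%:E)%E &
      (mcm (Phat ⊗ mp_star S) <= (- l)%:E)%E].
Proof.
move=> /Gamma_potential[|v /feasible_potential[vC vP vI]].
  by do 2![apply: is_Rmax_add => //]; exact: is_Rmax_scale.
have vCs := potential_star vC.
have hat x B : potential v x B -> potential v x (mp_star C ⊗ B ⊗ mp_star C).
  move=> vB; rewrite (_ : x = 0 + x + 0); last by lra.
  by apply: potential_mul => //; exact: potential_mul.
have vS : potential v 0 S by apply: potential_S_iter; exact: hat.
have vSs := potential_star vS.
split; [exact: potential_Gamma vC | exact: potential_Gamma vS | |].
  apply: (@potential_mcm _ _ v); rewrite -[l]addr0.
  exact: potential_mul (hat _ _ vI) vSs.
apply: (@potential_mcm _ _ v); rewrite -[- l]addr0.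
exact: potential_mul (hat _ _ vP) vSs.
Qed.

Lemma output_feasible (l : R) :
  Gamma (precedence_graph C) -> Gamma (precedence_graph S) ->
  (mcm (Ihat ⊗ mp_star S) <= l%:E)%E ->
  (mcm (Phat ⊗ mp_star S) <= (- l)%:E)%E ->
  Gamma (precedence_graph (l%:E ⊙ P ⊕ (- l)%:E ⊙ I ⊕ C)).
Proof.
move=> /(Gamma_potential hC)[v vC] GS lI lP.
have Cs := potential_Rmax (potential_star vC).
have hS : is_Rmax_mx S by apply: is_Rmax_S_iter; do !apply: is_Rmax_mul.
have [u uS] := Gamma_potential hS GS.
apply: elementary_nonpositive_Gamma => x p ux.
pose L c := if c then P else I.
have [w sw hw] := path_word C L l x (rcons p x).
have wn : (size w <= n)%N.
  have := max_card (mem (x :: p)).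
  by rewrite (card_uniqP ux) card_ord sw size_rcons.
apply: le_trans hw _; rewrite last_rcons.
rewrite -leeBrDl // sub0e -EFinN.
(* The claim is now that a diagonal entry is at most [l] times the excess of [Some false] over
   [Some true], the form of bound that [word_tr_le] gives. *)
apply: le_trans (le_mp_tr _ _) _.
have [[tr0 w0]|[w' [sw' cw' tr']]] := mp_tr_word_absorb L w vC.
  by rewrite !w0 subrr mul0r oppr0.
apply: le_trans tr' _.
have := @word_tr_le _ _ (fun c => mp_star C ⊗ L c ⊗ mp_star C) l u w' uS lI lP.
by rewrite !cw' -mulNr opprB; apply; exact: leq_trans wn.
Qed.

(** [rho] enters only by modifying [P] or [I], so both algorithms are instances of this equality. *)
Lemma algorithm_bodyE :
  algorithm_body P I C =
  [set l : R | Gamma (precedence_graph (l%:E ⊙ P ⊕ (- l)%:E ⊙ I ⊕ C))].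
Proof.
rewrite /algorithm_body -/Phat -/Ihat -/S.
apply/seteqP; split=> l /=.
  case: ifPn => // /negPn/asboolP GC; case: ifPn => // /negPn/asboolP GS.
  by case: ifP => // _ [lI]; rewrite leeNr; exact: output_feasible.
move=> /feasible_output[GC GS lI lP].
rewrite (asboolT GC) (asboolT GS) /=.
have lP' : (l%:E <= - mcm (Phat ⊗ mp_star S))%E by rewrite leeNr.
by rewrite ltNge (le_trans lI lP').
Qed.

End Correctness.

Theorem theorem1 (R : realType) (n : nat) (P I C : 'M[\bar R]_n) (rho : R)
    (hP : is_Rmax_mx P) (hI : is_Rmax_mx I) (hC : is_Rmax_mx C) :
  algorithm1 P I C rho =
    [set l : R | Gamma (precedence_graph
      (l%:E ⊙ (P ⊕ (- rho)%:E ⊙ mp_one) ⊕ (- l)%:E ⊙ I ⊕ C))] /\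
  algorithm2 P I C rho =
    [set l : R | Gamma (precedence_graph
      (l%:E ⊙ P ⊕ (- l)%:E ⊙ (I ⊕ rho%:E ⊙ mp_one) ⊕ C))].
Proof.
by split; apply: algorithm_bodyE => //; apply: is_Rmax_add => //;
  apply: is_Rmax_scale; exact: is_Rmax_one.
Qed.
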